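(* The function $\rho_0$ is a pseudometric on the family $\mathcal{G}_0$ of isometry classes of pointed geodesic metric spaces. For pointed geodesic metric spaces $(X,x_0)$ and $(Y,y_0)$, we have $\rho_0((X,x_0),(Y,y_0))=0$ if and only if $(X,x_0)\simeq(Y,y_0)$.
   Context: An extended metric space is a space with a metric taking values in $[0,+\infty]$. For pointed extended metric spaces, $(X,x_0)\precsim(Y,y_0)$ means: for any $x_1,\dots,x_N\in X$ there are $y_{i,k}\in Y$ ($i=0,\dots,N$, $k=1,2,\dots$) with $y_{0,k}=y_0$ and $d_X(x_i,x_j)\le\liminf_{k\to\infty}d_Y(y_{i,k},y_{j,k})$ for any distinct $i,j\in\{0,1,\dots,N\}$. $(X,x_0)\sim(Y,y_0)$ means $\precsim$ in both directions. The pointed Gromov-Hausdorff distance $d_{\mathrm{GH}}((X,x_0),(Y,y_0))$ of pointed compact metric spaces is the infimum of $\max\{d_{\mathrm H}(\varphi(X),\psi(Y)),d_Z(\varphi(x_0),\psi(y_0))\}$ over all isometric embeddings $\varphi:X\to Z$, $\psi:Y\to Z$ into compact metric spaces $Z$. $\mathcal{H}_0$ is the set of isometry classes of pointed compact metric spaces; $\mathcal{H}_0(N,D)$ its subset of spaces with at most $N$ points and diameter $\le D$; $\mathcal{P}_{(X,x_0)}:=\{(Y,y_0)\in\mathcal{H}_0\mid(Y,y_0)\precsim(X,x_0)\}$. Define $\rho_N((X,x_0),(Y,y_0)):=d_{\mathrm H}(\mathcal{P}_{(X,x_0)}\cap\mathcal{H}_0(N,N),\mathcal{P}_{(Y,y_0)}\cap\mathcal{H}_0(N,N))$,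 with $d_{\mathrm H}$ the Hausdorff distance with respect to the pointed GH metric, and $\rho:=\sum_{N=1}^\infty2^{-N}\rho_N$. $B(x_0,r)$ is the closed metric ball with the restricted metric; $tX$ is $X$ with metric $t\,d_X$. For pointed geodesic metric spaces, $$\rho_0((X,x_0),(Y,y_0)):=\int_{(0,+\infty)}\rho\big((r^{-1}B(x_0,r),x_0),(r^{-1}B(y_0,r),y_0)\big)\,re^{-r^2}\,dr.$$ $(X,x_0)\simeq(Y,y_0)$ (strongly equivalent) means $(B(x_0,r),x_0)\sim(B(y_0,r),y_0)$ for every $r>0$. *)

(* Defs.v *)
From HB Require Import structures.
From mathcomp Require Import all_boot all_order all_algebra.
From mathcomp Require Import all_classical all_reals all_analysis.
From mathcomp Require Import measurable_realfun.

Set Implicit Arguments.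
Unset Strict Implicit.
Unset Printing Implicit Defensive.

Import Order.TTheory GRing.Theory Num.Theory.

Local Open Scope classical_set_scope.
Local Open Scope card_scope.
Local Open Scope ring_scope.
Local Open Scope ereal_scope.

Record extMetric (R : realType) := ExtMetric {
  em_sort :> Type;
  edist : em_sort -> em_sort -> \bar R;
  edist_ge0 : forall x y, 0 <= edist x y;
  edist_eq0 : forall x y, edist x y = 0 <-> x = y;
  edist_sym : forall x y, edist x y = edist y x;
  edist_triangle : forall x y z, edist x z <= edist x y + edist y z }.

Arguments edist {R e}.

Record ptExtMetric (R : realType) := PtExtMetric {
  pem_space :> extMetric R;
  pem_point : pem_space }.

Record ptMetric (R : realType) := PtMetric {
  pm_space :> metricType R;
  pm_point : pm_space }.

Section MetricAsExtended.
Variables (R : realType) (X : metricType R).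

Let dist (x y : X) : \bar R := (mdist x y)%:E.

Let dist_ge0 x y : 0 <= dist x y.
Proof. by rewrite lee_fin mdist_ge0. Qed.

Let dist_eq0 x y : dist x y = 0 <-> x = y.
Proof.
split=> [[]|->]; first exact: mdist_positivity.
by rewrite /dist mdistxx.
Qed.

Let dist_sym x y : dist x y = dist y x.
Proof. by rewrite /dist metric_sym. Qed.

Let dist_triangle x y z : dist x z <= dist x y + dist y z.
Proof. by rewrite -EFinD lee_fin metric_triangle. Qed.

Definition ext_of_metric : extMetric R :=
  ExtMetric dist_ge0 dist_eq0 dist_sym dist_triangle.

End MetricAsExtended.

Definition ptExt_of_ptMetric (R : realType) (X : ptMetric R) : ptExtMetric R :=
  @PtExtMetric R (ext_of_metric X) (pm_point X).

Coercion ptExt_of_ptMetric : ptMetric >-> ptExtMetric.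

Section ClosedBall.
Variables (R : realType) (X : extMetric R) (x0 : X) (r : {posnum R}).

Let B := {x : X | edist x0 x <= r%:num%:E}.
Let dist (x y : B) : \bar R := edist (sval x) (sval y).

Let dist_ge0 x y : 0 <= dist x y.
Proof. exact: edist_ge0. Qed.

Let dist_eq0 x y : dist x y = 0 <-> x = y.
Proof.
split=> [/edist_eq0|->]; last exact/edist_eq0.
by case: x y => [x px] [y py] /= xy; apply: eq_exist.
Qed.

Let dist_sym x y : dist x y = dist y x.
Proof. exact: edist_sym. Qed.

Let dist_triangle x y z : dist x z <= dist x y + dist y z.
Proof. exact: edist_triangle. Qed.

Definition eball : extMetric R :=
  ExtMetric dist_ge0 dist_eq0 dist_sym dist_triangle.

Lemma eball_center_subproof : edist x0 x0 <= r%:num%:E.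
Proof. by rewrite (edist_eq0 x0 x0).2// lee_fin. Qed.

Definition eball_center : eball := exist _ x0 eball_center_subproof.

End ClosedBall.

Section Scale.
Variables (R : realType) (t : {posnum R}) (X : extMetric R).

Let dist (x y : X) : \bar R := t%:num%:E * edist x y.

Let dist_ge0 x y : 0 <= dist x y.
Proof. by rewrite mule_ge0// ?lee_fin// edist_ge0. Qed.

Let dist_eq0 x y : dist x y = 0 <-> x = y.
Proof.
split=> [|->]; last by rewrite /dist (edist_eq0 y y).2// mule0.
move/eqP; rewrite mule_eq0 => /orP[|/eqP/edist_eq0//].
by rewrite eqe gt_eqF.
Qed.

Let dist_sym x y : dist x y = dist y x.
Proof. by rewrite /dist edist_sym. Qed.

Let dist_triangle x y z : dist x z <= dist x y + dist y z.
Proof.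
rewrite /dist -ge0_muleDr ?edist_ge0//.
by apply: lee_wpmul2l; rewrite ?lee_fin// edist_triangle.
Qed.

Definition escale : extMetric R :=
  ExtMetric dist_ge0 dist_eq0 dist_sym dist_triangle.

End Scale.

(* (B(x0, r), x0) *)
Definition ptball (R : realType) (X : ptExtMetric R) (r : {posnum R}) :
    ptExtMetric R :=
  @PtExtMetric R (eball (pem_point X) r) (eball_center (pem_point X) r).

(* (tX, x0) *)
Definition ptscale (R : realType) (t : {posnum R}) (X : ptExtMetric R) :
    ptExtMetric R :=
  @PtExtMetric R (escale t X) (pem_point X).

Section Equivalence.
Variable R : realType.
Implicit Types X Y : ptExtMetric R.

Definition precsim X Y : Prop :=
  forall (N : nat) (x : 'I_N.+1 -> X), x ord0 = pem_point X ->
    exists y : 'I_N.+1 -> nat -> Y,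
      (forall k, y ord0 k = pem_point Y) /\
      (forall i j, i != j ->
         edist (x i) (x j) <= limn_einf (fun k => edist (y i k) (y j k))).

Definition esim X Y : Prop := precsim X Y /\ precsim Y X.

Definition strong_equiv X Y : Prop :=
  forall r : {posnum R}, esim (ptball X r) (ptball Y r).

End Equivalence.

(* Infimum of the e > 0 such that A and B lie in the e-neighbourhoods of each
   other, for an arbitrary distance-like function d. Subsets are plain
   predicates rather than classical sets because T will also be a type of
   metric spaces, which is too large a universe for set T. *)
Definition hausdorff_dist (R : realType) (T : Type) (d : T -> T -> \bar R)
    (A B : T -> Prop) : \bar R :=
  ereal_inf [set e%:E | e in [set e : R | [/\ (0 < e)%R,
    forall a, A a -> exists2 b, B b & d a b < e%:E &
    forall b, B b -> exists2 a, A a & d a b < e%:E]]].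

Section PointedMetricSpaces.
Variable R : realType.
Implicit Types X Y : ptMetric R.

Definition isometric_embedding (X Y : metricType R) (f : X -> Y) : Prop :=
  forall x x', mdist (f x) (f x') = mdist x x'.

Definition isometric X Y : Prop :=
  exists f : X -> Y, [/\ isometric_embedding f, range f = [set: Y] &
                         f (pm_point X) = pm_point Y].

Definition GH_dist X Y : \bar R :=
  ereal_inf [set c | exists (Z : metricType R) (f : X -> Z) (g : Y -> Z),
    [/\ compact [set: Z], isometric_embedding f, isometric_embedding g &
        c = maxe (hausdorff_dist (fun z z' => (mdist z z')%:E)
                                 (range f) (range g))
                 (mdist (f (pm_point X)) (g (pm_point Y)))%:E]].

(* A set of isometry classes of pointed metric spaces is represented by the
   isometry-invariant predicate satisfied by the members of these classes. *)
Definition H0 X : Prop := compact [set: X].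

Definition H0_bounded (N : nat) (D : R) X : Prop :=
  [/\ H0 X, [set: X] #<= `I_N & forall x y : X, (mdist x y <= D)%R].

(* The set P_X of the spaces of H0 below X. *)
Definition lower_set (X : ptExtMetric R) (Y : ptMetric R) : Prop :=
  H0 Y /\ precsim Y X.

Definition rho_ (N : nat) (X Y : ptExtMetric R) : \bar R :=
  hausdorff_dist GH_dist (fun A => lower_set X A /\ H0_bounded N N%:R A)
                         (fun A => lower_set Y A /\ H0_bounded N N%:R A).

Definition rho (X Y : ptExtMetric R) : \bar R :=
  \sum_(1 <= N <oo) ((2 ^- N)%:E * rho_ N X Y).

(* (r^-1 B(x0, r), x0) *)
Definition normalized_ball (X : ptExtMetric R) (r : {posnum R}) :
    ptExtMetric R :=
  ptscale (r%:num^-1)%:pos%R (ptball X r).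

(* Balls need a positive radius; the value 0 for r <= 0 is never used, since
   the integral below is over the positive reals. *)
Definition rho0_integrand X Y (r : R) : \bar R :=
  if pselect (0 < r)%R is left r_gt0 then
    rho (normalized_ball X (PosNum r_gt0)) (normalized_ball Y (PosNum r_gt0))
      * (r * expR (- r ^+ 2))%:E
  else 0.

Definition rho0 X Y : \bar R :=
  \int[@lebesgue_measure R]_(r in `]0%R, +oo[) rho0_integrand X Y r.

Definition geodesic (X : metricType R) : Prop :=
  forall x y : X, exists g : R -> X,
    [/\ g 0%R = x, g (mdist x y) = y &
        forall s t, (0 <= s <= mdist x y)%R -> (0 <= t <= mdist x y)%R ->
          mdist (g s) (g t) = `|s - t|%R].

Definition G0 X : Prop := geodesic X.

(* d induces a finite pseudometric on the isometry classes of spaces in S. *)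
Definition pseudometric_on_classes (S : ptMetric R -> Prop)
    (d : ptMetric R -> ptMetric R -> \bar R) : Prop :=
  [/\ forall X X' Y Y', S X -> S X' -> S Y -> S Y' ->
        isometric X X' -> isometric Y Y' -> d X Y = d X' Y',
      forall X Y, S X -> S Y -> 0 <= d X Y < +oo,
      forall X, S X -> d X X = 0,
      forall X Y, S X -> S Y -> d X Y = d Y X &
      forall X Y Z, S X -> S Y -> S Z -> d X Z <= d X Y + d Y Z].

End PointedMetricSpaces.

(* Main.v *)
From HB Require Import structures.
From mathcomp Require Import all_boot all_order all_algebra.
From mathcomp Require Import all_classical all_reals all_analysis.
From mathcomp Require Import measurable_realfun ring lra.
Require Import Defs.

Set Implicit Arguments.
Unset Strict Implicit.
Unset Printing Implicit Defensive.

Import Order.TTheory GRing.Theory Num.Theory.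
Import numFieldNormedType.Exports.

Local Open Scope classical_set_scope.
Local Open Scope card_scope.
Local Open Scope ring_scope.
Local Open Scope ereal_scope.

(** Two observations make everything elementary. First, the relation
[precsim] can be tested without limits: X is below Y exactly when every strict
lower bound on the distances of a finite pointed configuration of X can be
achieved by a configuration of Y ([precsimP]). Transitivity is then immediate.
Second, [rho_ N] only compares spaces with at most N points. For finite spaces
the Gromov-Hausdorff distance is governed by correspondences: a distance below
e gives a correspondence of distortion below 2e, and a correspondence of
distortion 2e lets one glue the two spaces into a finite metric space where
they are e-close ([GH_dist_correspondence], [GH_dist_le]). Composing
correspondences yields the triangle inequality for [rho_ N], hence for [rho].

If all [rho_ N] vanish for X of finite diameter, then any finite configuration
of X, seen as a finite metric space, is approximated in the Gromov-Hausdorff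
sense by spaces below Y, so its distances are almost achieved in Y: X is below
Y ([rhoN_eq0_precsim]). Conversely equivalent spaces have the same lower sets.
So [rho] of the normalized balls of radius r vanishes if and only if the balls
of radius r are equivalent.

In a geodesic space, sliding points toward the centre maps the ball of radius r
to the ball of radius s and moves points by at most |r - s|. Thus finite
configurations can be transferred between normalized balls of close radii with
a small loss in the distances. A loss of distance does not directly give a
nearby smaller metric: subtracting a constant destroys the triangle inequality.
Instead, given a finite space A below X, one keeps a maximal h-separated subset
of A and multiplies its metric by 1 - t; since all its nonzero distances exceed
h, each of them drops by at least t * h, which absorbs the loss
([lower_set_shrunk_net]), while A changes little ([GH_dist_shrunk_net]). Hence
[rho_ N] of the normalized balls is continuous in r, which gives the
measurability of the integrand, and the triangle inequality of [rho0] follows by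
integration. The integral is finite because [rho_ N] is at most N, so that [rho]
is at most 2.

Finally, if [rho0] vanishes then the balls of radius s are equivalent for almost
every s, in particular for radii s below and arbitrarily close to any given r;
sliding configurations of the ball of radius r into such smaller balls gives the
equivalence at r ([precsim_ball_left_limit]). *)

(** * Metric spaces from distance functions *)

Record metric_axioms (R : realType) (T : Type) (d : T -> T -> R) : Prop :=
  MetricAxioms {
    metric_axiom_xx : forall x, d x x = 0%R;
    metric_axiom_eq : forall x y, d x y = 0%R -> x = y;
    metric_axiom_sym : forall x y, d x y = d y x;
    metric_axiom_triangle : forall y x z, (d x z <= d x y + d y z)%R }.

(** A copy of [T] indexed by the proof that [d] is a metric: structure inference
on the copy recovers [d], even when [T] already carries another metric. *)
Definition metric_of (R : realType) (T : Type) (d : T -> T -> R)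
  (m : metric_axioms d) : Type := T.

Section MetricOf.
Variables (R : realType) (T : Type) (d : T -> T -> R) (m : metric_axioms d).

HB.instance Definition _ := gen_eqMixin (metric_of m).
HB.instance Definition _ := gen_choiceMixin (metric_of m).
HB.instance Definition _ := @isMetric.Build R (metric_of m) d
  (metric_axiom_xx m) (metric_axiom_eq m) (metric_axiom_sym m)
  (metric_axiom_triangle m).

Lemma mdist_metric_of (x y : metric_of m) : mdist x y = d x y.
Proof. by []. Qed.

End MetricOf.

(** * The relation precsim without limits *)

Section LimInf.
Variable R : realType.
Implicit Types (u : (\bar R)^nat) (c : R).

Lemma limn_einf_gt u c : c%:E < limn_einf u ->
  exists n, forall k, (n <= k)%N -> c%:E < u k.
Proof.
rewrite limn_einf_lim (cvg_lim _ (@cvg_einfs_sup R u))//.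
move=> /ereal_sup_gt[_ [n _ <-] cn]; exists n => k nk.
by apply: (lt_le_trans cn); apply: ereal_inf_lbound; exists k.
Qed.

Lemma le_limn_einf u (x : \bar R) :
  (forall c, c%:E < x -> exists n, forall k, (n <= k)%N -> c%:E < u k) ->
  x <= limn_einf u.
Proof.
move=> ux; have H c : c%:E < x -> c%:E <= limn_einf u.
  move=> /ux[n nu]; rewrite limn_einf_lim (cvg_lim _ (@cvg_einfs_sup R u))//.
  apply: (@le_trans _ _ (einfs u n)); last by apply: ereal_sup_ubound; exists n.
  by apply: le_ereal_inf_tmp => _ [k nk <-]; apply/ltW/nu.
case: x ux H => [r| |] ux H; last by rewrite leNye.
- apply/lee_subgt0Pr => e e0; rewrite -EFinB; apply: H.
  by rewrite lte_fin ltrBlDr ltrDl.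
- by rewrite (eq_infty (fun A => H A (ltry A))).
Qed.

End LimInf.

Section Precsim.
Variable R : realType.
Implicit Types X Y Z : ptExtMetric R.

(** A sequence of reals increasing to [x] from strictly below, for [0 <= x]. *)
Definition below (x : \bar R) (k : nat) : R :=
  match x with r%:E => (r - k.+1%:R^-1)%R | +oo => k%:R | -oo => 0%R end.

Lemma below_lt (x : \bar R) k : 0 <= x -> (below x k)%:E < x.
Proof.
case: x => [r| |]//= _; last by rewrite ltry.
by rewrite lte_fin ltrBlDr ltrDl invr_gt0.
Qed.

Lemma below_cvg (x : \bar R) c : c%:E < x ->
  exists n, forall k, (n <= k)%N -> (c < below x k)%R.
Proof.
case: x => [r| |]//.
- rewrite lte_fin -subr_gt0 => rc.
  pose n := Num.truncn (r - c)^-1; exists n => k nk /=.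
  rewrite ltrBrDl -ltrBrDr invf_plt ?posrE//.
  apply: lt_le_trans (_ : n.+1%:R <= _)%R; first exact: truncnS_gt.
  by rewrite ler_nat ltnS.
- move=> _; pose n := Num.truncn c; exists n.+1 => k nk /=.
  apply: lt_le_trans (_ : n.+1%:R <= _)%R; first exact: truncnS_gt.
  by rewrite ler_nat.
Qed.

Definition precsim_approx X Y : Prop :=
  forall (N : nat) (x : 'I_N.+1 -> X) (c : 'I_N.+1 -> 'I_N.+1 -> R),
    x ord0 = pem_point X ->
    (forall i j, i != j -> (c i j)%:E < edist (x i) (x j)) ->
    exists2 y : 'I_N.+1 -> Y, y ord0 = pem_point Y &
      forall i j, i != j -> (c i j)%:E < edist (y i) (y j).

(** A limit inferior above [x] means that every strict lower bound of [x] is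
eventually exceeded. Since a configuration has finitely many pairs of points,
one index serves them all; conversely the limits are recovered by applying the
approximate property to the bounds [below (edist (x i) (x j)) k]. *)
Lemma precsimP X Y : precsim X Y <-> precsim_approx X Y.
Proof.
split=> [XY N x c x0 cx|XY N x x0].
- have [y [y0 xy]] := XY N x x0.
  have /choice[n nP] : forall p : 'I_N.+1 * 'I_N.+1, exists n, p.1 != p.2 ->
      forall k, (n <= k)%N -> (c p.1 p.2)%:E < edist (y p.1 k) (y p.2 k).
    move=> [i j]/=; have [->|ij] := eqVneq i j; first by exists 0%N.
    have [n nk] := limn_einf_gt (lt_le_trans (cx i j ij) (xy i j ij)).
    by exists n.
  pose m := (\max_p n p)%N.
  exists (fun i => y i m) => // i j ij.
  exact: (nP (i, j) ij m (leq_bigmax (i, j))).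
- have /choice[y yP] : forall k : nat, exists y : 'I_N.+1 -> Y,
      y ord0 = pem_point Y /\ forall i j, i != j ->
      (below (edist (x i) (x j)) k)%:E < edist (y i) (y j).
    move=> k; have [||y y0 xy] :=
      XY N x (fun i j => below (edist (x i) (x j)) k) => //.
      by move=> i j _; apply/below_lt/edist_ge0.
    by exists y.
  exists (fun i k => y k i); split=> [k|i j ij]; first by case: (yP k).
  apply: le_limn_einf => c /below_cvg[n nP]; exists n => k nk.
  by apply: lt_trans ((yP k).2 i j ij); rewrite lte_fin nP.
Qed.

Lemma precsim_trans X Y Z : precsim X Y -> precsim Y Z -> precsim X Z.
Proof.
move=> /precsimP XY /precsimP YZ; apply/precsimP => N x c x0 cx.
have [y y0 cy] := XY N x c x0 cx.
exact: YZ y0 cy.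
Qed.

Lemma expanding_precsim X Y (f : X -> Y) : f (pem_point X) = pem_point Y ->
  (forall x x', edist x x' <= edist (f x) (f x')) -> precsim X Y.
Proof.
move=> f0 fd; apply/precsimP => N x c x0 cx; exists (f \o x).
  by rewrite /= x0.
by move=> i j ij; apply: lt_le_trans (cx i j ij) (fd _ _).
Qed.

Lemma precsim_refl X : precsim X X.
Proof. exact: (@expanding_precsim X X id). Qed.

Lemma precsim_scale (t : {posnum R}) X Y :
  precsim X Y -> precsim (ptscale t X) (ptscale t Y).
Proof.
move=> /precsimP XY; apply/precsimP => N x c x0 cx.
have [||y y0 cy] := XY N x (fun i j => t%:num^-1 * c i j)%R => //.
  by move=> i j ij; rewrite EFinM lte_pdivrMl//; exact: (cx i j ij).
by exists y => // i j ij; have := cy i j ij; rewrite EFinM lte_pdivrMl.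
Qed.

End Precsim.

(** * Hausdorff distance *)

Section Hausdorff.
Variables (R : realType) (T : Type) (d : T -> T -> \bar R).
Implicit Types A B C : T -> Prop.

Lemma hausdorff_dist_ge0 A B : 0 <= hausdorff_dist d A B.
Proof. by apply: le_ereal_inf_tmp => _ [e [e0 _ _] <-]; rewrite lee_fin ltW. Qed.

Lemma hausdorff_dist_le A B (e : R) : (0 <= e)%R ->
  (forall a e', A a -> (e < e')%R -> exists2 b, B b & d a b < e'%:E) ->
  (forall b e', B b -> (e < e')%R -> exists2 a, A a & d a b < e'%:E) ->
  hausdorff_dist d A B <= e%:E.
Proof.
move=> e_ge0 AB BA; apply/lee_addgt0Pr => s s0; rewrite -EFinD.
have es : (e < e + s)%R by rewrite ltrDl.
apply: ereal_inf_lbound; exists (e + s)%R => //; split.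
- exact: le_lt_trans es.
- by move=> a /AB; apply.
- by move=> b /BA; apply.
Qed.

Lemma hausdorff_dist_lt A B (e : R) : hausdorff_dist d A B < e%:E ->
  exists e', [/\ (0 < e' < e)%R, (forall a, A a -> exists2 b, B b & d a b < e'%:E) &
    (forall b, B b -> exists2 a, A a & d a b < e'%:E)].
Proof.
by move=> /ereal_inf_lt[_ [e' [e'0 AB BA] <-] e'e]; 
exists e'; split=> //; rewrite e'0.
Qed.

Lemma hausdorff_dist_eqP A A' B B' :
  (forall x, A x <-> A' x) -> (forall x, B x <-> B' x) ->
  hausdorff_dist d A B = hausdorff_dist d A' B'.
Proof.
move=> AA' BB'; congr (ereal_inf [set e%:E | e in _]).
apply/seteqP; split=> e /= [e0 AB BA]; split=> //.
- by move=> a /AA'/AB[b /BB' ? ?]; exists b.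
- by move=> b /BB'/BA[a /AA' ? ?]; exists a.
- by move=> a /AA'/AB[b /BB' ? ?]; exists b.
- by move=> b /BB'/BA[a /AA' ? ?]; exists a.
Qed.

Lemma hausdorff_dist_sym A B : (forall x y, d x y = d y x) ->
  hausdorff_dist d A B = hausdorff_dist d B A.
Proof.
move=> dC; congr (ereal_inf [set e%:E | e in _]).
apply/seteqP; split=> e /= [e0 AB BA]; split=> // x Ax.
- by have [y By xy] := BA x Ax; exists y => //; rewrite dC.
- by have [y By xy] := AB x Ax; exists y => //; rewrite dC.
- by have [y By xy] := BA x Ax; exists y => //; rewrite dC.
- by have [y By xy] := AB x Ax; exists y => //; rewrite dC.
Qed.

(** The triangle inequality is asked of [d] only on the members of [A], [B] and
[C], and in strict form, because the Gromov-Hausdorff distance is shown to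
satisfy it on finite spaces only. *)
Lemma hausdorff_dist_triangle A B C :
  (forall a b c e1 e2, A a -> B b -> C c ->
    d a b < e1%:E -> d b c < e2%:E -> d a c < (e1 + e2)%:E) ->
  hausdorff_dist d A C <= hausdorff_dist d A B + hausdorff_dist d B C.
Proof.
move=> dT.
have := hausdorff_dist_ge0 B C; have := hausdorff_dist_ge0 A B.
case AB: (hausdorff_dist d A B) => [ab| |]//; last first.
  by case: (hausdorff_dist d B C) => // *; rewrite leey.
case BC: (hausdorff_dist d B C) => [bc| |]//; last first.
  by move=> *; rewrite addey// leey.
rewrite !lee_fin => ab0 bc0; rewrite -EFinD; apply/lee_addgt0Pr => e e0.
have [|e1 [/andP[e10 e1e] AB1 AB2]] := @hausdorff_dist_lt A B (ab + e / 2).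
  by rewrite AB lte_fin ltrDl divr_gt0.
have [|e2 [/andP[e20 e2e] BC1 BC2]] := @hausdorff_dist_lt B C (bc + e / 2).
  by rewrite BC lte_fin ltrDl divr_gt0.
rewrite -EFinD; apply: (@le_trans _ _ (e1 + e2)%:E); last by rewrite lee_fin; lra.
apply: ereal_inf_lbound; exists (e1 + e2)%R => //; split; first exact: addr_gt0.
- move=> a Aa; have [b Bb abe] := AB1 a Aa; have [c Cc bce] := BC1 b Bb.
  by exists c => //; apply: dT abe bce.
- move=> c Cc; have [b Bb bce] := BC2 c Cc; have [a Aa abe] := AB2 b Bb.
  by exists a => //; apply: dT abe bce.
Qed.

End Hausdorff.

(** * Gromov-Hausdorff distance of finite spaces *)

Section GromovHausdorff.
Variable R : realType.
Implicit Types A B C : ptMetric R.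

Definition correspondence A B (r : A -> B -> Prop) : Prop :=
  [/\ forall a, exists b, r a b, forall b, exists a, r a b &
      r (pm_point A) (pm_point B)].

Definition distortion_le A B (r : A -> B -> Prop) (e : R) : Prop :=
  forall a b a' b', r a b -> r a' b' -> (`|mdist a a' - mdist b b'| <= e)%R.

Lemma GH_dist_sym A B : GH_dist A B = GH_dist B A.
Proof.
congr ereal_inf; apply/seteqP; split=> c [Z [f [g [cZ fI gI ->]]]];
  exists Z, g, f; split=> //; rewrite metric_sym; congr maxe;
  by apply: hausdorff_dist_sym => x y; rewrite metric_sym.
Qed.

(** Relate the points at distance less than some [e' < e] in a common ambient
space; [e'] must also exceed the distance of the two base points. *)
Lemma GH_dist_correspondence A B (e : R) : GH_dist A B < e%:E ->
  exists (r : A -> B -> Prop) e',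
    [/\ correspondence r, distortion_le r (e' *+ 2) & (0 < e' < e)%R].
Proof.
move=> /ereal_inf_lt[_ [Z [f [g [cZ fI gI ->]]]]].
rewrite gt_max => /andP[/hausdorff_dist_lt[e1 [/andP[e10 e1e] fg gf]] fge].
pose e2 := Num.max e1 ((mdist (f (pm_point A)) (g (pm_point B)) + e) / 2)%R.
have e2e : (e2 < e)%R by rewrite gt_max e1e/=; move: fge; rewrite lte_fin; lra.
exists (fun a b => mdist (f a) (g b) < e2)%R, e2; split; first split.
- move=> a; have [|_ [b _ <-] ab] := fg (f a); first by exists a.
  by exists b; rewrite lt_max -lte_fin ab.
- move=> b; have [|_ [a _ <-] ab] := gf (g b); first by exists b.
  by exists a; rewrite lt_max -lte_fin ab.
- by rewrite lt_max; apply/orP; right; move: fge; rewrite lte_fin; lra.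
- move=> a b a' b' /= ab a'b'; rewrite -fI -gI.
  have t1 := metric_triangle (f a) (g b) (f a').
  have t2 := metric_triangle (g b) (g b') (f a').
  have t3 := metric_triangle (g b) (f a) (g b').
  have t4 := metric_triangle (f a) (f a') (g b').
  rewrite (metric_sym (g b') (f a')) in t2; rewrite (metric_sym (g b) (f a)) in t3.
  by rewrite ler_norml; lra.
- by rewrite e2e lt_max e10.
Qed.

Section Gluing.
Variables (A B : ptMetric R) (r : A -> B -> Prop) (e : R).
Hypotheses (rC : correspondence r) (re : distortion_le r (e *+ 2)) (e0 : (0 < e)%R).

Let bridges (a : A) (b : B) : set R :=
  [set s | exists p q, r p q /\ s = (mdist a p + e + mdist q b)%R].

(** The gluing puts every pair of related points at distance at most [e]: a path
from [a] to [b] runs to a related pair, crosses the bridge of length [e], and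
continues to [b]. *)
Definition cross_dist (a : A) (b : B) : R := inf (bridges a b).

Lemma cross_dist_ge (s : R) a b :
  (forall p q, r p q -> s <= mdist a p + e + mdist q b)%R ->
  (s <= cross_dist a b)%R.
Proof.
move=> H; have [_ _ r0] := rC; apply: lb_le_inf.
  by exists (mdist a (pm_point A) + e + mdist (pm_point B) b)%R,
    (pm_point A), (pm_point B).
by move=> _ [p [q [pq ->]]]; apply: H.
Qed.

Lemma cross_dist_le a b p q :
  r p q -> (cross_dist a b <= mdist a p + e + mdist q b)%R.
Proof.
move=> pq; apply: ge_inf; last by exists p, q.
by exists 0%R => _ [p' [q' [_ ->]]]; rewrite !addr_ge0 ?mdist_ge0// ltW.
Qed.

Lemma cross_dist_gt0 a b : (0 < cross_dist a b)%R.
Proof.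
apply: lt_le_trans e0 _; apply: cross_dist_ge => p q _.
by have := mdist_ge0 a p; have := mdist_ge0 q b; lra.
Qed.

Lemma cross_dist_related a b : r a b -> (cross_dist a b <= e)%R.
Proof. by move=> /(cross_dist_le a b); rewrite !mdistxx addr0 add0r. Qed.

Definition glue_dist (x y : A + B) : R :=
  match x, y with
  | inl a, inl a' => mdist a a'
  | inl a, inr b => cross_dist a b
  | inr b, inl a => cross_dist a b
  | inr b, inr b' => mdist b b'
  end.

Lemma cross_dist_triangleA a a' b :
  (cross_dist a b <= mdist a a' + cross_dist a' b)%R.
Proof.
rewrite -lerBlDl; apply: cross_dist_ge => p q /(cross_dist_le a b).
by have := metric_triangle a a' p; lra.
Qed.

Lemma cross_dist_triangleB a b b' :
  (cross_dist a b <= cross_dist a b' + mdist b' b)%R.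
Proof.
rewrite -lerBlDr; apply: cross_dist_ge => p q /(cross_dist_le a b).
by have := metric_triangle q b' b; lra.
Qed.

(** Going over one bridge and coming back over another costs [2 * e], which is at
least the amount by which the correspondence can distort the distance between
the feet of the bridges. This is where the bound on the distortion enters. *)
Lemma mdist_crossA a a' b : (mdist a a' <= cross_dist a b + cross_dist a' b)%R.
Proof.
rewrite -lerBlDl; apply: cross_dist_ge => p' q' pq'.
rewrite lerBlDl -lerBlDr; apply: cross_dist_ge => p q pq.
have /ler_normlP[_] := re pq pq'.
have := metric_triangle a p a'; have := metric_triangle p p' a'.
have := metric_triangle q b q'.
by rewrite (metric_sym p' a') (metric_sym b q'); lra.
Qed.

Lemma mdist_crossB a b b' : (mdist b b' <= cross_dist a b + cross_dist a b')%R.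
Proof.
rewrite -lerBlDl; apply: cross_dist_ge => p' q' pq'.
rewrite lerBlDl -lerBlDr; apply: cross_dist_ge => p q pq.
have /ler_normlP[+ _] := re pq pq'.
have := metric_triangle b q b'; have := metric_triangle q q' b'.
have := metric_triangle p a p'.
by rewrite (metric_sym p a) (metric_sym b q); lra.
Qed.

Lemma glue_metric : metric_axioms glue_dist.
Proof.
split.
- by case=> x /=; rewrite mdistxx.
- case=> x [y|y]//=; first by move/mdist_positivity ->.
  + by move=> xy; have := cross_dist_gt0 x y; rewrite xy ltxx.
  + by move=> xy; have := cross_dist_gt0 y x; rewrite xy ltxx.
  + by move/mdist_positivity ->.
- by case=> x [y|y]//=; rewrite metric_sym.
- case=> y [x|x] [z|z] /=.
  + exact: metric_triangle.
  + exact: cross_dist_triangleA.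
  + by rewrite addrC metric_sym cross_dist_triangleA.
  + exact: mdist_crossB.
  + exact: mdist_crossA.
  + exact: cross_dist_triangleB.
  + by rewrite addrC metric_sym cross_dist_triangleB.
  + exact: metric_triangle.
Qed.

(** The glued space is finite, hence an admissible compact ambient space. *)
Lemma GH_dist_le : finite_set [set: A] -> finite_set [set: B] ->
  GH_dist A B <= e%:E.
Proof.
move=> finA finB; have [rA rB r0] := rC.
pose Z : metricType R := metric_of glue_metric.
pose f : A -> Z := inl; pose g : B -> Z := inr.
apply: (@le_trans _ _ (maxe
  (hausdorff_dist (fun z z' : Z => (mdist z z')%:E) (range f) (range g))
  (mdist (f (pm_point A)) (g (pm_point B)))%:E)).
  apply: ereal_inf_lbound; exists Z, f, g; split=> //.
  apply: finite_compact.
  rewrite (_ : [set: Z] = range f `|` range g); last first.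
    by apply/esym/seteqP; split=> // -[a|b] _; [left; exists a|right; exists b].
  by rewrite finite_setU; split; apply: finite_image.
rewrite ge_max lee_fin; apply/andP; split; last exact: cross_dist_related.
apply: hausdorff_dist_le; first exact: ltW.
- move=> _ e' [a _ <-] ee'; have [b ab] := rA a; exists (g b); first by exists b.
  by rewrite lte_fin (le_lt_trans _ ee')//; exact: cross_dist_related.
- move=> _ e' [b _ <-] ee'; have [a ab] := rB b; exists (f a); first by exists a.
  by rewrite lte_fin (le_lt_trans _ ee')//; exact: cross_dist_related.
Qed.

End Gluing.

(** Correspondences compose and their distortions add up. *)
Lemma GH_dist_triangle_lt A B C (e1 e2 : R) :
  finite_set [set: A] -> finite_set [set: C] ->
  GH_dist A B < e1%:E -> GH_dist B C < e2%:E -> GH_dist A C < (e1 + e2)%:E.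
Proof.
move=> finA finC.
move=> /GH_dist_correspondence[r [e1' [[rA rB r0] re /andP[e10 e1e]]]].
move=> /GH_dist_correspondence[s [e2' [[sB sC s0] se /andP[e20 e2e]]]].
apply: (@le_lt_trans _ _ (e1' + e2')%:E); last by rewrite lte_fin ltrD.
apply: (@GH_dist_le _ _ (fun a c => exists2 b, r a b & s b c)) => //.
- split.
  + by move=> a; have [b ab] := rA a; have [c bc] := sB b; exists c, b.
  + by move=> c; have [b bc] := sC c; have [a ab] := rB b; exists a, b.
  + by exists (pm_point B).
- move=> a c a' c' [b ab bc] [b' ab' bc'].
  have := re _ _ _ _ ab ab'; have := se _ _ _ _ bc bc'.
  by rewrite !ler_norml; lra.
- exact: addr_gt0.
Qed.

End GromovHausdorff.

(** * The truncated distances *)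

Section TruncatedDistance.
Variable R : realType.
Implicit Types (X Y Z : ptExtMetric R) (A B : ptMetric R).

Lemma H0_bounded_finite N (D : R) A : H0_bounded N D A -> finite_set [set: A].
Proof. by move=> [_ AN _]; apply: card_le_finite AN _; exact: finite_II. Qed.

Lemma H0_boundedI N (D : R) A : [set: A] #<= `I_N ->
  (forall x y : A, mdist x y <= D)%R -> H0_bounded N D A.
Proof.
move=> AN AD; split=> //; apply: finite_compact.
by apply: card_le_finite AN _; exact: finite_II.
Qed.

Lemma GH_dist_refl A (e : R) : finite_set [set: A] -> (0 < e)%R ->
  GH_dist A A < e%:E.
Proof.
move=> finA e0; apply: (@le_lt_trans _ _ (e / 2)%:E); last by rewrite lte_fin; lra.
apply: (@GH_dist_le _ _ _ eq) => //.
- by split=> // a; exists a.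
- by move=> a b a' b' -> ->; rewrite subrr normr0; lra.
- by lra.
Qed.

Lemma rhoN_ge0 N X Y : 0 <= rho_ N X Y.
Proof. exact: hausdorff_dist_ge0. Qed.

Lemma rhoN_sym N X Y : rho_ N X Y = rho_ N Y X.
Proof. by apply: hausdorff_dist_sym; exact: GH_dist_sym. Qed.

Lemma rhoN_triangle N X Y Z : rho_ N X Z <= rho_ N X Y + rho_ N Y Z.
Proof.
apply: hausdorff_dist_triangle => A B C e1 e2 [_ bA] _ [_ bC].
apply: GH_dist_triangle_lt; first exact: H0_bounded_finite bA.
exact: H0_bounded_finite bC.
Qed.

Lemma rhoN_refl N X : rho_ N X X = 0.
Proof.
apply/eqP; rewrite eq_le rhoN_ge0 andbT; apply: hausdorff_dist_le => //.
- move=> A e [XA bA] e0; exists A => //; apply: GH_dist_refl => //.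
  exact: H0_bounded_finite bA.
- move=> A e [XA bA] e0; exists A => //; apply: GH_dist_refl => //.
  exact: H0_bounded_finite bA.
Qed.

Lemma rhoN_esim N X X' Y Y' : esim X X' -> esim Y Y' -> rho_ N X Y = rho_ N X' Y'.
Proof.
move=> [XX' X'X] [YY' Y'Y]; apply: hausdorff_dist_eqP => A.
- by split=> -[[hA AX] bA]; do ![split=> //]; exact: precsim_trans AX _.
- by split=> -[[hA AX] bA]; do ![split=> //]; exact: precsim_trans AX _.
Qed.

Lemma rhoN_esim0 N X Y : esim X Y -> rho_ N X Y = 0.
Proof.
move=> XY; rewrite -(rhoN_refl N Y); apply: rhoN_esim => //.
by split; exact: precsim_refl.
Qed.

Lemma unit_metric : metric_axioms (fun _ _ : unit => 0%R : R).
Proof.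
split.
- by [].
- by case=> -[].
- by [].
- by move=> *; rewrite addr0.
Qed.

(** The one-point space lies below every space, so lower sets are never empty. *)
Definition one_point : ptMetric R := @PtMetric R (metric_of unit_metric) tt.

Lemma mdist_one_point (x y : one_point) : mdist x y = 0%R :> R.
Proof. by []. Qed.

Lemma one_point_bounded N X : (0 < N)%N ->
  lower_set X one_point /\ H0_bounded N N%:R one_point.
Proof.
move=> N0; have b : H0_bounded N N%:R one_point.
  apply: H0_boundedI => [|x y]; last by rewrite mdist_one_point.
  have -> : [set: one_point] = (fun _ => tt) @` `I_N.
    by apply/esym/seteqP; split=> // -[] _; exists 0%N.
  exact: card_image_le.
split=> //; split; first by case: b.
apply: (@expanding_precsim _ one_point X (fun _ => pem_point X)) => // x y.
by rewrite /= mdist_one_point edist_ge0.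
Qed.

(** Every competitor has diameter at most [N], hence is within [N] of a point. *)
Lemma rhoN_le N X Y : (0 < N)%N -> rho_ N X Y <= N%:R%:E.
Proof.
move=> N0; have H A : H0_bounded N N%:R A -> GH_dist A one_point <= N%:R%:E.
  move=> bA; apply: (@GH_dist_le _ _ _ (fun _ _ => True)).
  - by split=> [a|b|]; [exists tt | exists (pm_point A) | ].
  - move=> a b a' b' _ _; rewrite mdist_one_point subr0.
    rewrite ger0_norm ?mdist_ge0//; case: bA => _ _ /(_ a a') /le_trans; apply.
    by rewrite mulr2n lerDl.
  - by rewrite ltr0n.
  - exact: H0_bounded_finite bA.
  - by apply: H0_bounded_finite (one_point_bounded X N0).2.
apply: hausdorff_dist_le => // A e [_ bA] Ne; exists one_point;
  try exact: one_point_bounded.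
- by apply: le_lt_trans (H A bA) _; rewrite lte_fin.
- by rewrite GH_dist_sym; apply: le_lt_trans (H A bA) _; rewrite lte_fin.
Qed.

Lemma exists_pos_le (I : finType) (P : pred I) (f : I -> R) :
  (forall i, P i -> 0 < f i)%R ->
  exists2 e : R, (0 < e)%R & forall i, P i -> (e <= f i)%R.
Proof.
move=> f0; exists (\big[Num.min/1%R]_(i | P i) f i).
  by elim/big_ind: _ => // x y x0 y0; rewrite lt_min x0.
by move=> i Pi; exact: bigmin_le_cond.
Qed.

(** The range of a finite configuration, as a metric space of its own. The points
[x i] may coincide, so the carrier is the range and not the set of indices. *)
Section FiniteSubspace.
Variables (X : ptExtMetric R) (D : R).
Hypothesis XD : forall x y : X, edist x y <= D%:E.
Variables (n : nat) (x : 'I_n.+1 -> X).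
Hypothesis x0 : x ord0 = pem_point X.

Let T := {z : X | exists i, x i = z}.

Let d (y z : T) : R := fine (edist (sval y) (sval z)).

Let dE y z : (d y z)%:E = edist (sval y) (sval z).
Proof.
by rewrite fineK// ge0_fin_numE ?edist_ge0// (le_lt_trans (XD _ _))// ltry.
Qed.

Let d_metric : metric_axioms d.
Proof.
split.
- by move=> y; apply: EFin_inj; rewrite dE; apply/edist_eq0.
- move=> y z yz; have := dE y z; rewrite yz => {yz} /esym/edist_eq0.
  by case: y z => [y yx] [z zx] /= yz; apply: eq_exist.
- by move=> y z; apply: EFin_inj; rewrite !dE edist_sym.
- by move=> y w z; rewrite -lee_fin EFinD !dE edist_triangle.
Qed.

Definition finite_subspace : ptMetric R :=
  @PtMetric R (metric_of d_metric) (exist _ (pem_point X) (ex_intro _ ord0 x0)).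

Definition finite_subspace_point (i : 'I_n.+1) : finite_subspace :=
  exist _ (x i) (ex_intro _ i erefl).

Lemma mdist_finite_subspace i j :
  (mdist (finite_subspace_point i) (finite_subspace_point j))%:E =
  edist (x i) (x j).
Proof. by rewrite mdist_metric_of dE. Qed.

Lemma finite_subspace_lower N : (n < N)%N -> (D <= N%:R)%R ->
  lower_set X finite_subspace /\ H0_bounded N N%:R finite_subspace.
Proof.
move=> nN DN; have b : H0_bounded N N%:R finite_subspace.
  apply: H0_boundedI => [|y z]; last first.
    by rewrite mdist_metric_of -lee_fin dE (le_trans (XD _ _))// lee_fin.
  have -> : [set: finite_subspace] =
      (finite_subspace_point \o (fun k => inord k)) @` `I_N.
    apply/esym/seteqP; split=> // -[z [i xz]] _; exists i => /=.
      exact: leq_trans (ltn_ord i) nN.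
    by rewrite inord_val; apply: eq_exist.
  exact: card_image_le.
split=> //; split; first by case: b.
apply: (@expanding_precsim _ finite_subspace X sval) => // y z.
by rewrite /= mdist_metric_of dE.
Qed.

End FiniteSubspace.

(** A configuration of [X] spans a member of the lower set of [X], which is
approximated by some [B] below [Y]; the correspondence between them turns the
configuration into one of [B], whose distances are almost as large, and [B]
being below [Y] moves it to [Y]. *)
Lemma rhoN_eq0_precsim X Y (D : R) : (forall x y : X, edist x y <= D%:E) ->
  (forall N, (0 < N)%N -> rho_ N X Y = 0) -> precsim X Y.
Proof.
move=> XD rho0; apply/precsimP => n x c x0 cx.
pose A := finite_subspace XD x0; pose a := finite_subspace_point XD x0.
have [e e0 ec] : exists2 e : R, (0 < e)%R & forall p : 'I_n.+1 * 'I_n.+1,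
    p.1 != p.2 -> (e <= mdist (a p.1) (a p.2) - c p.1 p.2)%R.
  apply: exists_pos_le => -[i j] /= ij.
  by rewrite subr_gt0 -lte_fin mdist_finite_subspace cx.
(* [N] bounds both the number of points and the diameter of the configuration. *)
pose N := maxn n.+1 (Num.truncn D).+1.
have nN : (n < N)%N by rewrite /N leq_maxl.
have DN : (D <= N%:R)%R.
  by apply/ltW/(lt_le_trans (truncnS_gt D)); rewrite ler_nat leq_maxr.
have : rho_ N X Y < (e / 2)%:E.
  by rewrite rho0 ?lte_fin ?divr_gt0//; exact: leq_trans nN.
move=> /hausdorff_dist_lt[e' [/andP[e'0 e'e] AB _]].
have [B [[_ BY] _] ABe] := AB A (finite_subspace_lower XD x0 nN DN).
have [r [e'' [[rA _ r0] re /andP[e''0 e''e]]]] := GH_dist_correspondence ABe.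
have /choice[b ab] : forall i, exists b, r (a i) b by move=> i; exact: rA.
(* Several points may be related to [x ord0]; the base point has to be its copy,
   since [precsim] only concerns pointed configurations. *)
pose b' i := if i == ord0 then pm_point B else b i.
have ab' i : r (a i) (b' i).
  rewrite /b'; have [->|_] := eqVneq i ord0; last exact: ab.
  by rewrite (_ : a ord0 = pm_point A)//; apply: eq_exist.
have /precsimP/(_ n b' c) := BY; apply; first by rewrite /b' eqxx.
move=> i j ij; rewrite lte_fin.
have /ler_normlP[_ /=] := re _ _ _ _ (ab' i) (ab' j).
have /= := ec (i, j) ij.
by lra.
Qed.

(** Greedy selection: run through the points and keep those at distance more than
[h] from the points kept so far, starting with the base point. *)
Lemma separated_net A (h : R) : finite_set [set: A] -> (0 <= h)%R ->
  exists S : set A, [/\ S (pm_point A),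
    forall a b, S a -> S b -> a <> b -> (h < mdist a b)%R &
    forall a, exists2 b, S b & (mdist a b <= h)%R].
Proof.
move=> /finite_seqP[s sE] h0.
suff [S [S0 Ssep Snet]] : exists S : set A, [/\ S (pm_point A),
    forall a b, S a -> S b -> a <> b -> (h < mdist a b)%R &
    forall a, a \in s -> exists2 b, S b & (mdist a b <= h)%R].
  by exists S; split=> // a; apply: Snet; have : [set: A] a by []; rewrite sE.
elim: s {sE} => [|c s [S [S0 Ssep Snet]]].
  by exists [set pm_point A]; split=> // a b -> ->.
have [[b Sb cb]|far] := pselect (exists2 b, S b & (mdist c b <= h)%R).
  exists S; split=> // a; rewrite inE => /predU1P[->|]; last exact: Snet.
  by exists b.
have {}far b : S b -> (h < mdist c b)%R.
  by move=> Sb; rewrite ltNge; apply/negP => cb; apply: far; exists b.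
exists (c |` S); split; first by right.
- move=> a b [->|Sa] [->|Sb] ab //; first exact: far.
  + by rewrite metric_sym; exact: far.
  + exact: Ssep.
- move=> a; rewrite inE => /predU1P[->|/Snet[b Sb ab]].
    by exists c; [left | rewrite mdistxx].
  by exists b => //; right.
Qed.

Section ShrunkNet.
Variables (A : ptMetric R) (S : set A) (S0 : S (pm_point A)) (t : R).
Hypothesis (t01 : (0 < t < 1)%R).

Let d (x y : {a | S a}) : R := ((1 - t) * mdist (sval x) (sval y))%R.

Let d_metric : metric_axioms d.
Proof.
have t1 : (0 < 1 - t)%R by case/andP: t01; lra.
split; rewrite /d.
- by move=> x; rewrite mdistxx mulr0.
- move=> [x Sx] [y Sy] /= /eqP; rewrite mulf_eq0 gt_eqF//= => /eqP.
  by move=> /mdist_positivity xy; apply: eq_exist.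
- by move=> x y; rewrite metric_sym.
- by move=> y x z; rewrite -mulrDr ler_pM2l// metric_triangle.
Qed.

Definition shrunk_net : ptMetric R :=
  @PtMetric R (metric_of d_metric) (exist _ (pm_point A) S0).

Lemma mdist_shrunk_net (x y : shrunk_net) :
  mdist x y = ((1 - t) * mdist (sval x) (sval y))%R.
Proof. by rewrite mdist_metric_of. Qed.

Lemma shrunk_net_card : [set: shrunk_net] #<= [set: A].
Proof.
pose f a : shrunk_net :=
  if pselect (S a) is left Sa then exist _ a Sa else pm_point shrunk_net.
have -> : [set: shrunk_net] = f @` [set: A].
  apply/esym/seteqP; split=> // -[a Sa] _; exists a => //.
  by rewrite /f; case: pselect => // Sa'; apply: eq_exist.
exact: card_image_le.
Qed.

Lemma shrunk_net_bounded N D : H0_bounded N D A -> H0_bounded N D shrunk_net.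
Proof.
case/andP: t01 => t0 t1 [_ AN AD]; apply: H0_boundedI => [|x y].
  exact: card_le_trans shrunk_net_card AN.
rewrite mdist_shrunk_net; have := AD (sval x) (sval y).
have := mdist_ge0 (sval x) (sval y); nra.
Qed.

End ShrunkNet.

End TruncatedDistance.

(** * Stability of the truncated distances *)

Section Perturbation.
Variable R : realType.
Implicit Types (X Y : ptExtMetric R) (A B : ptMetric R).

(** Finite configurations of [X] can be copied into [Y], losing at most [e] in
each distance. Distances may increase freely, which suits [precsim]. *)
Definition transfer X Y (e : R) : Prop :=
  forall n (x : 'I_n.+1 -> X), x ord0 = pem_point X ->
    exists2 y : 'I_n.+1 -> Y, y ord0 = pem_point Y &
      forall i j, edist (x i) (x j) <= edist (y i) (y j) + e%:E.

(** Shrinking an [h]-separated set by the factor [1 - t] lowers each nonzero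
distance by at least [t * h]. Half of this pays for the loss of the transfer,
the other half leaves the strict margin needed to use that [A] is below [X]. *)
Lemma lower_set_shrunk_net X Y A (S : set A) (S0 : S (pm_point A)) (t h : R)
    (t01 : (0 < t < 1)%R) :
  finite_set [set: A] -> (0 < h)%R ->
  (forall a b, S a -> S b -> a <> b -> (h < mdist a b)%R) ->
  transfer X Y (t * h / 2) ->
  precsim A X -> lower_set Y (shrunk_net S0 t01).
Proof.
move=> finA h0 Ssep XY /precsimP AX; split.
  apply: finite_compact; apply: card_le_finite finA.
  exact: shrunk_net_card.
have th0 : (0 < t * h)%R by case/andP: t01 => t0 _; exact: mulr_gt0.
apply/precsimP => n x c x0 cx.
have [||y y0 ay] :=
  AX n (fun i => sval (x i))
    (fun i j => mdist (sval (x i)) (sval (x j)) - t * h / 2)%R.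
- by rewrite x0.
- by move=> i j _; rewrite lte_fin ltrBlDr ltrDl divr_gt0.
have [z z0 yz] := XY n y y0.
exists z => // i j ij.
have := cx i j ij; rewrite lte_fin mdist_shrunk_net.
have [xij|xij] := pselect (sval (x i) = sval (x j)).
  rewrite xij mdistxx mulr0 -lte_fin => /lt_le_trans; apply.
  exact: edist_ge0.
have := Ssep _ _ (svalP (x i)) (svalP (x j)) xij.
have := lt_le_trans (ay i j ij) (yz i j).
case: (edist (z i) (z j)) (edist_ge0 (z i) (z j)) => [s| |]//=; last first.
  by move=> *; rewrite ltry.
rewrite -EFinD !lte_fin; have [t0 t1] := andP t01; nra.
Qed.

(** Relate a point of [A] to the points of the net within [h]: passing to the net
distorts distances by at most [2 * h] and shrinking by at most [t * D]. *)
Lemma GH_dist_shrunk_net A (S : set A) (S0 : S (pm_point A)) (t h : R) N (D : R)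
    (t01 : (0 < t < 1)%R) : (0 < h)%R ->
  H0_bounded N D A -> (forall a, exists2 b, S b & (mdist a b <= h)%R) ->
  GH_dist A (shrunk_net S0 t01) <= (h + t * D / 2)%:E.
Proof.
move=> h0 bA Snet; have D0 : (0 <= D)%R.
  by case: bA => _ _ /(_ (pm_point A) (pm_point A)); rewrite mdistxx.
have [t0 t1] := andP t01.
apply: (@GH_dist_le _ _ _
  (fun a (b : shrunk_net S0 t01) => (mdist a (sval b) <= h)%R)).
- split.
  + by move=> a; have [b Sb ab] := Snet a; exists (exist _ b Sb).
  + by move=> b; exists (sval b); rewrite mdistxx ltW.
  + by rewrite /= mdistxx ltW.
- move=> a b a' b' ab a'b'; rewrite mdist_shrunk_net.
  case: bA => _ _ /(_ (sval b) (sval b')) bD.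
  have b0 := mdist_ge0 (sval b) (sval b').
  have t2 := metric_triangle a (sval b) a'.
  have t3 := metric_triangle (sval b) (sval b') a'.
  have t4 := metric_triangle (sval b) a (sval b').
  have t5 := metric_triangle a a' (sval b').
  rewrite (metric_sym (sval b') a') in t3; rewrite (metric_sym (sval b) a) in t4.
  by rewrite ler_norml; apply/andP; split; nra.
- by rewrite ltr_wpDr// divr_ge0// mulr_ge0// ltW.
- exact: H0_bounded_finite bA.
- exact: (H0_bounded_finite (shrunk_net_bounded S0 t01 bA)).
Qed.

(** The admissible loss [d] depends on [N] and [e] only. This uniformity is what
gives continuity of [r |-> rho_ N] along balls. *)
Lemma rhoN_transfer N (e : R) : (0 < e)%R -> exists2 d : R, (0 < d)%R &
  forall X Y, transfer X Y d -> transfer Y X d -> rho_ N X Y <= e%:E.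
Proof.
move=> e0.
(* These choices make the Gromov-Hausdorff error [h + t * N / 2] at most
   [3 * e / 4], while [t < 1] keeps the shrunken distances positive. *)
pose h := (e / 4)%R; pose t := Num.min (1 / 2)%R (e / (N.+1)%:R)%R.
have h0 : (0 < h)%R by rewrite /h; lra.
have t01 : (0 < t < 1)%R.
  rewrite /t lt_min divr_gt0//= divr_gt0//= gt_min; apply/orP; left; lra.
have tN : (t * N%:R <= e)%R.
  apply: (@le_trans _ _ (e / N.+1%:R * N%:R)%R).
    by rewrite ler_wpM2r// ge_min lexx orbT.
  by rewrite mulrAC ler_pdivrMr// ler_pM2l// ler_nat.
have [t0 t1] := andP t01.
exists (t * h / 2)%R; first by rewrite divr_gt0// mulr_gt0.
have H X Y : transfer X Y (t * h / 2) -> forall A e',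
    lower_set X A /\ H0_bounded N N%:R A -> (e < e')%R ->
    exists2 B, lower_set Y B /\ H0_bounded N N%:R B & GH_dist A B < e'%:E.
  move=> XY A e' [[_ AX] bA] ee'; have finA := H0_bounded_finite bA.
  have [S [S0 Ssep Snet]] := separated_net finA (ltW h0).
  exists (shrunk_net S0 t01).
    split; first exact: lower_set_shrunk_net Ssep XY AX.
    exact: shrunk_net_bounded.
  apply: le_lt_trans (GH_dist_shrunk_net S0 t01 h0 bA Snet) _.
  by rewrite lte_fin /h; lra.
move=> X Y XY YX; apply: hausdorff_dist_le; first exact: ltW.
- exact: H.
- by move=> B e' YB ee'; have [A XA AB] := H Y X YX B e' YB ee'; exists A => //;
    rewrite GH_dist_sym.
Qed.

End Perturbation.

(** * Balls in geodesic spaces *)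

Section Balls.
Variable R : realType.
Implicit Types X Y Z : ptMetric R.

(** Points outside the smaller ball slide along a geodesic toward the centre until
they reach the sphere of radius [s]. *)
Lemma geodesic_contraction X (r s : R) (x : X) : geodesic X ->
  (0 < s)%R -> (mdist (pm_point X) x <= r)%R ->
  exists2 y : X, (mdist (pm_point X) y <= s)%R & (mdist x y <= Num.max 0 (r - s))%R.
Proof.
move=> gX s0 xr; have [xs|xs] := leP (mdist (pm_point X) x) s.
  by exists x => //; rewrite mdistxx le_max lexx.
have [g [g0 g1 gI]] := gX (pm_point X) x.
have x0 := mdist_ge0 (pm_point X) x.
exists (g s).
  rewrite -[X in mdist X]g0 gI ?lexx//; last by rewrite !ltW.
  by rewrite sub0r normrN gtr0_norm.
rewrite -[X in mdist X]g1 gI ?lexx ?andbT//; last by rewrite !ltW.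
rewrite ger0_norm; last by rewrite subr_ge0 ltW.
by rewrite le_max; apply/orP; right; lra.
Qed.

Lemma ball_contraction X (r s : {posnum R}) n (x : 'I_n.+1 -> ptball X r) :
  geodesic X -> x ord0 = pem_point (ptball X r) ->
  exists2 y : 'I_n.+1 -> ptball X s, y ord0 = pem_point (ptball X s) &
    forall i, (mdist (sval (x i)) (sval (y i)) <= Num.max 0 (r%:num - s%:num))%R.
Proof.
move=> gX x0.
have /choice[y yP] : forall i, exists y : ptball X s,
    (mdist (sval (x i)) (sval y) <= Num.max 0 (r%:num - s%:num))%R.
  move=> i; have : edist (pem_point X) (sval (x i)) <= r%:num%:E := svalP (x i).
  rewrite lee_fin => /(geodesic_contraction gX (gt0 s))[y ys xy].
  by exists (exist _ y ys).
exists (fun i => if i == ord0 then pem_point (ptball X s) else y i) => [|i].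
  by rewrite eqxx.
case: eqVneq => [->|_]; last exact: yP.
by rewrite x0 /= mdistxx le_max lexx.
Qed.

Lemma edist_normalized_ball X (r : {posnum R}) (x y : normalized_ball X r) :
  edist x y = (r%:num^-1 * mdist (sval x) (sval y))%:E.
Proof. by []. Qed.

Lemma normalized_ball_diam X (r : {posnum R}) (x y : normalized_ball X r) :
  edist x y <= 2%:E.
Proof.
case: x y => [x xr] [y yr]; rewrite edist_normalized_ball /= lee_fin.
rewrite ler_pdivrMl//; move: xr yr; rewrite /= !lee_fin => xr yr.
have := metric_triangle x (pm_point X) y.
by rewrite (metric_sym x (pm_point X)); lra.
Qed.

(** Contracting costs at most [2 * |r - s|] in each distance, and replacing the
factor [r^-1] by [s^-1] costs as much again since distances in the ball of
radius [r] are at most [2 * r]; the sum is then divided by [s]. *)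
Lemma normalized_ball_transfer X (r s : {posnum R}) : geodesic X ->
  transfer (normalized_ball X r) (normalized_ball X s)
    (4 * `|r%:num - s%:num| / s%:num)%R.
Proof.
move=> gX n x x0.
have [y y0 yP] := @ball_contraction X r s n x gX x0.
exists y => //.
move=> i j; rewrite !edist_normalized_ball -EFinD lee_fin.
have yi := yP i; have yj := yP j.
have := normalized_ball_diam (x i) (x j).
rewrite edist_normalized_ball lee_fin ler_pdivrMl//.
have := metric_triangle (sval (x i)) (sval (y i)) (sval (x j)).
have := metric_triangle (sval (y i)) (sval (y j)) (sval (x j)).
rewrite (metric_sym (sval (y j)) (sval (x j))).
have := mdist_ge0 (sval (x i)) (sval (x j)).
move: yi yj.
move: (mdist (sval (x i)) (sval (y i))) (mdist (sval (x j)) (sval (y j))) => u v.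
move: (mdist (sval (x i)) (sval (x j))) (mdist (sval (y i)) (sval (x j))).
move: (mdist (sval (y i)) (sval (y j))) => c a b.
have r0 : (0 < r%:num)%R by [].
have s0 : (0 < s%:num)%R by [].
set m := Num.max _ _; set l := `|_|%R => um vm a0 bcv aub ar.
have ml : (m <= l)%R by rewrite /m ge_max /l normr_ge0 ler_norm.
have sl : (s%:num - r%:num <= l)%R by rewrite /l distrC ler_norm.
rewrite -(ler_pM2l s0) mulrDr.
have -> : (s%:num * (s%:num^-1 * c) = c)%R by field.
have -> : (s%:num * (4 * l / s%:num) = 4 * l)%R by field.
have -> : (s%:num * (r%:num^-1 * a) = a + (s%:num - r%:num) * (r%:num^-1 * a))%R.
  by field.
have /andP[q0 q2] : (0 <= r%:num^-1 * a <= 2)%R.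
  by rewrite ler_pdivrMl// ar andbT mulr_ge0// invr_ge0 ltW.
move: (r%:num^-1 * a)%R q0 q2 => q q0 q2.
have l0 : (0 <= l)%R by rewrite /l normr_ge0.
have : ((s%:num - r%:num) * q <= l * 2)%R.
  by apply: le_trans (ler_wpM2l l0 q2); exact: ler_wpM2r.
by lra.
Qed.

End Balls.

Section BallsComparison.
Variable R : realType.
Implicit Types X Y Z : ptMetric R.

Lemma precsim_normalized_ball X Y (r : {posnum R}) :
  precsim (normalized_ball X r) (normalized_ball Y r) <->
  precsim (ptball X r) (ptball Y r).
Proof.
split; last exact: precsim_scale.
have E Z (z z' : ptball Z r) :
    r%:num%:E * ((r%:num^-1)%:E * edist z z') = edist z z'.
  by rewrite muleA -EFinM mulfV ?mul1r.
move=> /(@precsim_scale _ r) XY; apply: precsim_trans (precsim_trans _ XY) _.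
- apply: (@expanding_precsim _ (ptball X r) (ptscale r (normalized_ball X r))
    (fun z => z)) => // x x'.
  by rewrite -{1}E.
- apply: (@expanding_precsim _ (ptscale r (normalized_ball Y r)) (ptball Y r)
    (fun z => z)) => // x x'.
  by rewrite -[leRHS]E.
Qed.

Lemma esim_normalized_ball X Y (r : {posnum R}) :
  esim (normalized_ball X r) (normalized_ball Y r) <->
  esim (ptball X r) (ptball Y r).
Proof. by split=> -[XY YX]; split; apply/precsim_normalized_ball. Qed.

(** A configuration of the ball of radius [r] satisfying strict bounds still
satisfies them after contraction to a radius [s] close to [r]; the copy found in
the ball of radius [s] of [Y] lies in the larger ball of radius [r]. *)
Lemma precsim_ball_left_limit X Y (r : {posnum R}) : geodesic X ->
  (forall d : R, (0 < d)%R ->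
     exists2 s : {posnum R}, (r%:num - d < s%:num < r%:num)%R &
       precsim (ptball X s) (ptball Y s)) ->
  precsim (ptball X r) (ptball Y r).
Proof.
move=> gX XY; apply/precsimP => n x c x0 cx.
have [e e0 ec] : exists2 e : R, (0 < e)%R & forall p : 'I_n.+1 * 'I_n.+1,
    p.1 != p.2 -> (e <= mdist (sval (x p.1)) (sval (x p.2)) - c p.1 p.2)%R.
  apply: exists_pos_le => -[i j] /= ij.
  by rewrite subr_gt0 -lte_fin; exact: (cx i j ij).
have [|s /andP[rs sr] /precsimP XYs] := XY (e / 2)%R; first by rewrite divr_gt0.
have [x' x'0 xx'] := @ball_contraction _ X r s n x gX x0.
have [i j ij|y y0 cy] := XYs n x' c x'0.
  rewrite lte_fin; have /= := ec (i, j) ij.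
  have t1 := metric_triangle (sval (x i)) (sval (x' i)) (sval (x j)).
  have t2 := metric_triangle (sval (x' i)) (sval (x' j)) (sval (x j)).
  rewrite (metric_sym (sval (x' j)) (sval (x j))) in t2.
  have := xx' i; have := xx' j; rewrite (max_idPr _); last by rewrite subr_ge0 ltW.
  by lra.
have sub (z : Y) : edist (pem_point Y) z <= s%:num%:E ->
    edist (pem_point Y) z <= r%:num%:E.
  by move=> /le_trans; apply; rewrite lee_fin ltW.
exists (fun i => exist _ (sval (y i)) (sub _ (svalP (y i)))) => //.
by apply: eq_exist; rewrite y0.
Qed.

Lemma isometric_sym X Y : isometric X Y -> isometric Y X.
Proof.
move=> [f [fI fS f0]].
have /choice[g gP] : forall y : Y, exists x, f x = y.
  by move=> y; have : [set: Y] y by []; rewrite -fS => -[x _ <-]; exists x.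
have fK x : g (f x) = x by apply: mdist_positivity; rewrite -fI gP mdistxx.
exists g; split; first by move=> y y'; rewrite -fI !gP.
- by apply/seteqP; split=> // x _; exists (f x).
- by rewrite -f0.
Qed.

Lemma isometric_precsim_ball X Y (r : {posnum R}) : isometric X Y ->
  precsim (ptball X r) (ptball Y r).
Proof.
move=> [f [fI _ f0]].
have fB (x : X) : edist (pem_point X) x <= r%:num%:E ->
    edist (pem_point Y) (f x) <= r%:num%:E.
  by rewrite !lee_fin /= -f0 fI.
apply: (@expanding_precsim _ (ptball X r) (ptball Y r)
  (fun x => exist _ (f (sval x)) (fB _ (svalP x)))).
- by apply: eq_exist.
- by move=> x x'; rewrite lee_fin fI.
Qed.

Lemma isometric_strong_equiv X Y : isometric X Y -> strong_equiv X Y.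
Proof.
move=> XY r; split; first exact: isometric_precsim_ball.
exact/isometric_precsim_ball/isometric_sym.
Qed.

Lemma rhoN_normalized_ball_near N X (r : {posnum R}) (e : R) : geodesic X ->
  (0 < e)%R -> exists2 d : R, (0 < d)%R &
  forall s : {posnum R}, (`|r%:num - s%:num| < d)%R ->
    rho_ N (normalized_ball X r) (normalized_ball X s) <= e%:E.
Proof.
move=> gX e0; have [d d0 H] := rhoN_transfer N e0.
have r0 : (0 < r%:num)%R by [].
exists (Num.min (r%:num / 2) (d * r%:num / 8))%R.
  by rewrite lt_min !divr_gt0// mulr_gt0.
move=> s; rewrite lt_min => /andP[rs2 rsd].
have s0 : (0 < s%:num)%R by [].
have rs : (r%:num / 2 < s%:num)%R.
  by have := le_lt_trans (ler_norm _) rs2; lra.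
have W (u v : {posnum R}) : (r%:num / 2 < v%:num)%R ->
    (`|u%:num - v%:num| < d * r%:num / 8)%R ->
    transfer (normalized_ball X u) (normalized_ball X v) d.
  move=> rv uv n x x0.
  have [y y0 xy] := @normalized_ball_transfer _ X u v gX n x x0.
  exists y => // i j; apply: le_trans (xy i j) _; rewrite leeD2l// lee_fin.
  rewrite ler_pdivrMr//.
  have : (d * (r%:num / 2) <= d * v%:num)%R by rewrite ler_pM2l// ltW.
  by lra.
apply: H; apply: W => //; first by lra.
by rewrite distrC.
Qed.

End BallsComparison.

(** * The series rho *)

Section RhoSeries.
Variable R : realType.
Implicit Types X Y Z : ptExtMetric R.

Let term_ge0 X Y N : 0 <= (2 ^- N)%:E * rho_ N X Y.
Proof. by rewrite mule_ge0 ?rhoN_ge0// lee_fin invr_ge0 exprn_ge0. Qed.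

Lemma rho_ge0 X Y : 0 <= rho X Y.
Proof. by apply: nneseries_ge0 => N _ _. Qed.

Lemma rho_sym X Y : rho X Y = rho Y X.
Proof. by apply: eq_eseriesr => N _; rewrite rhoN_sym. Qed.

Lemma rho_triangle X Y Z : rho X Z <= rho X Y + rho Y Z.
Proof.
rewrite -nneseriesD//; apply: lee_nneseries => // N _.
rewrite -ge0_muleDr ?rhoN_ge0//; apply: lee_wpmul2l; last exact: rhoN_triangle.
by rewrite lee_fin invr_ge0 exprn_ge0.
Qed.

Lemma rho_esim X X' Y Y' : esim X X' -> esim Y Y' -> rho X Y = rho X' Y'.
Proof.
by move=> XX' YY'; apply: eq_eseriesr => N _; rewrite (rhoN_esim N XX' YY').
Qed.

Lemma rho_esim0 X Y : esim X Y -> rho X Y = 0.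
Proof. by move=> XY; apply: eseries0 => N _ _; rewrite rhoN_esim0// mule0. Qed.

Lemma rho_eq0 X Y N : (0 < N)%N -> rho X Y = 0 -> rho_ N X Y = 0.
Proof.
move=> N0 rho0; apply/eqP; rewrite eq_le rhoN_ge0 andbT.
have : \sum_(1 <= k < N.+1) (2 ^- k)%:E * rho_ k X Y <= rho X Y.
  by apply: nneseries_lim_ge => k _ _.
rewrite rho0 big_nat_recr//= => H.
have {}H : (2 ^- N)%:E * rho_ N X Y <= 0.
  by apply: le_trans H; rewrite leeDr// sume_ge0.
by move: H; rewrite pmule_rle0// lte_fin invr_gt0 exprn_gt0.
Qed.

Lemma sum_natmul_halfX n :
  (\sum_(1 <= k < n.+1) 2 ^- k * k%:R = 2 - n.+2%:R * 2 ^- n :> R)%R.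
Proof.
elim: n => [|n IHn]; first by rewrite big_geq// expr0 invr1 mulr1 subrr.
rewrite big_nat_recr//= IHn exprS invfM.
rewrite -[n.+3]addn3 -[n.+2]addn2 -[n.+1]addn1 !natrD.
by move: (2 ^- n)%R => q; field.
Qed.

Lemma rho_le2 X Y : rho X Y <= 2%:E.
Proof.
apply: lime_le; first exact: is_cvg_nneseries.
apply: nearW => n; case: n => [|n]; first by rewrite big_geq// lee_fin.
apply: (@le_trans _ _ (\sum_(1 <= k < n.+1) (2 ^- k * k%:R)%:E)).
  rewrite [leLHS]big_nat [leRHS]big_nat; apply: lee_sum => k /andP[k0 _].
  rewrite EFinM; apply: lee_wpmul2l; last exact: rhoN_le.
  by rewrite lee_fin invr_ge0 exprn_ge0.
rewrite sumEFin lee_fin sum_natmul_halfX gerBl.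
by rewrite mulr_ge0// invr_ge0 exprn_ge0.
Qed.

End RhoSeries.

Lemma rhoN_quadrangle (R : realType) N (X X' Y Y' : ptExtMetric R) :
  rho_ N X Y <= rho_ N X' Y' + (rho_ N X X' + rho_ N Y Y').
Proof.
apply: le_trans (rhoN_triangle N X X' Y) _.
rewrite addeCA; apply: leeD2l; rewrite [rho_ N Y Y']rhoN_sym; exact: rhoN_triangle.
Qed.

(** * The integrand *)

Section Integrand.
Variable R : realType.
Implicit Types X Y Z : ptMetric R.

(** The value 0 at nonpositive radii makes this a function on the whole line,
matching [rho0_integrand]. *)
Definition ball_rho N X Y (r : R) : \bar R :=
  if pselect (0 < r)%R is left r0 then
    rho_ N (normalized_ball X (PosNum r0)) (normalized_ball Y (PosNum r0))
  else 0.

Lemma ball_rhoE N X Y (r : {posnum R}) :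
  ball_rho N X Y r%:num = rho_ N (normalized_ball X r) (normalized_ball Y r).
Proof.
rewrite /ball_rho; case: pselect => [r0|]; last by [].
by rewrite (_ : PosNum r0 = r)//; exact: val_inj.
Qed.

Lemma rho0_integrandE X Y (r : {posnum R}) : rho0_integrand X Y r%:num =
  rho (normalized_ball X r) (normalized_ball Y r) *
    (r%:num * expR (- r%:num ^+ 2))%:E.
Proof.
rewrite /rho0_integrand; case: pselect => [r0|]; last by [].
by rewrite (_ : PosNum r0 = r)//; exact: val_inj.
Qed.

Let weight (r : R) : R := (r * expR (- r ^+ 2))%R.

Let weight_gt0 (r : {posnum R}) : (0 < weight r%:num)%R.
Proof. by rewrite /weight mulr_gt0// expR_gt0. Qed.

Lemma rho0_integrand_ge0 X Y r : 0 <= rho0_integrand X Y r.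
Proof.
rewrite /rho0_integrand; case: pselect => // r0; rewrite mule_ge0 ?rho_ge0//.
by rewrite lee_fin (ltW (weight_gt0 (PosNum r0))).
Qed.

Lemma ball_rho_fineK N X Y (r : R) : (0 < N)%N ->
  (fine (ball_rho N X Y r))%:E = ball_rho N X Y r.
Proof.
move=> N0; rewrite fineK// /ball_rho; case: pselect => // r0.
rewrite ge0_fin_numE ?rhoN_ge0//; apply: le_lt_trans (rhoN_le _ _ N0) _.
by rewrite ltry.
Qed.

(** Both arguments of [rho_ N] move continuously, so the quadrangle inequality
bounds the variation of their distance. *)
Lemma continuous_ball_rho N X Y : (0 < N)%N -> geodesic X -> geodesic Y ->
  {in `]0%R, +oo[%classic, continuous (fun r => fine (ball_rho N X Y r))}.
Proof.
move=> N0 gX gY r; rewrite inE/= in_itv/= andbT => r0.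
pose r' := PosNum r0; apply/cvgrPdist_le => e e0.
have e2 : (0 < e / 2)%R by rewrite divr_gt0.
have [dX dX0 HX] := @rhoN_normalized_ball_near R N X r' _ gX e2.
have [dY dY0 HY] := @rhoN_normalized_ball_near R N Y r' _ gY e2.
near=> s.
have s0 : (0 < s)%R by near: s; exact: lt_nbhsr.
pose s' := PosNum s0.
have rsX : (`|r - s| < dX)%R.
  by near: s; apply/nbhs_ballP; exists dX.
have rsY : (`|r - s| < dY)%R.
  by near: s; apply/nbhs_ballP; exists dY.
have {}HX := HX s' rsX; have {}HY := HY s' rsY.
have HXY := leeD HX HY; rewrite -EFinD -splitr in HXY.
rewrite ler_distlC; apply/andP; split.
- rewrite lerBlDr -lee_fin EFinD !ball_rho_fineK//.
  rewrite (ball_rhoE N X Y r') (ball_rhoE N X Y s').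
  by apply: le_trans (rhoN_quadrangle _ _ _ _ _) (leeD2l _ HXY).
- rewrite -lee_fin EFinD !ball_rho_fineK//.
  rewrite (ball_rhoE N X Y r') (ball_rhoE N X Y s').
  apply: le_trans (rhoN_quadrangle _ _ _ _ _) (leeD2l _ _).
  by rewrite ![rho_ _ (normalized_ball _ s') _]rhoN_sym.
Unshelve. all: by end_near. Qed.

Lemma measurable_rho0_integrand X Y : geodesic X -> geodesic Y ->
  measurable_fun (`]0%R, +oo[ : set R) (rho0_integrand X Y).
Proof.
move=> gX gY.
have mN N : (0 < N)%N -> measurable_fun (`]0%R, +oo[ : set R) (ball_rho N X Y).
  move=> N0; have -> : ball_rho N X Y = EFin \o (fun r => fine (ball_rho N X Y r)).
    by apply/funext => r /=; rewrite ball_rho_fineK.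
  apply/measurable_EFinP; apply: open_continuous_measurable_fun => //.
  exact: continuous_ball_rho.
have mw : measurable_fun (`]0%R, +oo[ : set R) (EFin \o weight).
  apply/measurable_EFinP; apply: measurable_funTS.
  apply: measurable_funM => //; apply: measurableT_comp => //.
  by apply: measurableT_comp => //; exact: measurable_funX.
have ms : measurable_fun (`]0%R, +oo[ : set R)
    (fun r => \sum_(i <oo | i \in leq 1) (2 ^- i)%:E * ball_rho i X Y r).
  apply: ge0_emeasurable_sum => [k r|k k0].
    rewrite /= in_itv/= andbT => r0 _; rewrite (ball_rhoE k X Y (PosNum r0)).
    by rewrite mule_ge0 ?rhoN_ge0// lee_fin invr_ge0 exprn_ge0.
  by apply: measurable_funeM; exact: mN.
apply: eq_measurable_fun (emeasurable_funM ms mw) => r.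
rewrite inE/= in_itv/= andbT => r0.
rewrite (rho0_integrandE X Y (PosNum r0)); congr (_ * _).
rewrite /rho [RHS]eseries_cond.
apply: eq_eseriesr => k _.
by rewrite (ball_rhoE k X Y (PosNum r0)).
Qed.

Lemma rho0_integrand_triangle X Y Z r :
  rho0_integrand X Z r <= rho0_integrand X Y r + rho0_integrand Y Z r.
Proof.
have [r0|r0] := pselect (0 < r)%R; last first.
  by rewrite /rho0_integrand; case: pselect => //; rewrite adde0.
rewrite !(rho0_integrandE _ _ (PosNum r0)) -ge0_muleDl ?rho_ge0//.
apply: lee_wpmul2r; last exact: rho_triangle.
by rewrite lee_fin (ltW (weight_gt0 (PosNum r0))).
Qed.

Lemma rho0_integrand_strong_equiv X X' Y Y' r :
  strong_equiv X X' -> strong_equiv Y Y' ->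
  rho0_integrand X Y r = rho0_integrand X' Y' r.
Proof.
move=> XX' YY'; rewrite /rho0_integrand; case: pselect => // r0.
by congr (_ * _); apply: rho_esim; exact/esim_normalized_ball.
Qed.

Lemma rho0_integrand_strong_equiv0 X Y r : strong_equiv X Y ->
  rho0_integrand X Y r = 0.
Proof.
move=> XY; rewrite /rho0_integrand; case: pselect => // r0.
by rewrite rho_esim0 ?mul0e//; exact/esim_normalized_ball.
Qed.

Lemma rho0_integrand_eq0 X Y (r : {posnum R}) :
  rho0_integrand X Y r%:num = 0 -> precsim (ptball X r) (ptball Y r).
Proof.
rewrite rho0_integrandE => /eqP; rewrite mule_eq0 [in X in _ || X]eqe.
rewrite (gt_eqF (weight_gt0 r)) orbF => /eqP rho0.
apply/precsim_normalized_ball.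
apply: (rhoN_eq0_precsim (@normalized_ball_diam _ X r)) => N N0.
exact: rho_eq0.
Qed.

(** From [r <= expR r] and [r - r ^+ 2 <= 1 - r] one gets
[r * expR (- r ^+ 2) <= expR 1 * expR (- r)], which reduces integrability to
that of the exponential density of rate 1. *)
Lemma rho0_integrand_le X Y (r : R) : (0 < r)%R ->
  rho0_integrand X Y r <= (2 * expR 1)%:E * (exponential_pdf 1 r)%:E.
Proof.
move=> r0; rewrite (rho0_integrandE X Y (PosNum r0)) -EFinM.
apply: (@le_trans _ _ (2%:E * (weight r)%:E)).
  apply: lee_wpmul2r; last exact: rho_le2.
  by rewrite lee_fin (ltW (weight_gt0 (PosNum r0))).
rewrite -EFinM lee_fin -mulrA ler_pM2l// (exponential_pdfE _ (ltW r0)).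
rewrite mul1r mulN1r -expRD /weight.
apply: (@le_trans _ _ (expR r * expR (- r ^+ 2))%R).
  by rewrite ler_wpM2r ?expR_ge0//; have := expR_ge1Dx r; lra.
rewrite -expRD ler_expR; have : (0 <= (r - 1) ^+ 2)%R by exact: sqr_ge0.
by rewrite sqrrB1; lra.
Qed.

End Integrand.

(** * The pseudometric rho0 *)

Section Rho0.
Variable R : realType.
Implicit Types X Y Z : ptMetric R.

Local Notation mu := (@lebesgue_measure R).

Lemma rho0_ge0 X Y : 0 <= rho0 X Y.
Proof. by apply: integral_ge0 => r _; exact: rho0_integrand_ge0. Qed.

Lemma rho0_sym X Y : rho0 X Y = rho0 Y X.
Proof.
apply: eq_integral => r _; rewrite /rho0_integrand; case: pselect => // r0.
by rewrite rho_sym.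
Qed.

Lemma rho0_lty X Y : geodesic X -> geodesic Y -> rho0 X Y < +oo.
Proof.
move=> gX gY; pose g (r : R) := (2 * expR 1)%:E * (exponential_pdf 1 r)%:E.
have mpdf : measurable_fun [set: R] (fun r : R => (exponential_pdf 1 r)%:E).
  by apply/measurable_EFinP; exact: measurable_exponential_pdf.
have mg : measurable_fun [set: R] g by exact: measurable_funeM.
have c0 : (0 <= 2 * expR 1 :> R)%R by rewrite mulr_ge0// expR_ge0.
have pdf0 (r : R) : 0 <= (exponential_pdf 1 r)%:E.
  by rewrite lee_fin exponential_pdf_ge0.
have g0 r : 0 <= g r by rewrite mule_ge0.
apply: (@le_lt_trans _ _ (\int[mu]_(r in `]0%R, +oo[) g r)).
  apply: ge0_le_integral => //.
  - by move=> r _; exact: rho0_integrand_ge0.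
  - exact: measurable_rho0_integrand.
  - exact: measurable_funTS.
  - by move=> r; rewrite /= in_itv/= andbT; exact: rho0_integrand_le.
apply: (@le_lt_trans _ _ (\int[mu]_r g r)).
  exact: ge0_subset_integral.
rewrite ge0_integralZl_EFin// integral_exponential_pdf// mule1.
exact: ltry.
Qed.

Lemma rho0_triangle X Y Z : geodesic X -> geodesic Y -> geodesic Z ->
  rho0 X Z <= rho0 X Y + rho0 Y Z.
Proof.
move=> gX gY gZ; have mXY := measurable_rho0_integrand gX gY.
have mYZ := measurable_rho0_integrand gY gZ.
rewrite /rho0 -ge0_integralD//; try by move=> r _; exact: rho0_integrand_ge0.
apply: ge0_le_integral => //.
- by move=> r _; exact: rho0_integrand_ge0.
- exact: measurable_rho0_integrand.
- exact: emeasurable_funD.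
- by move=> r _; exact: rho0_integrand_triangle.
Qed.

Lemma rho0_strong_equiv X X' Y Y' : strong_equiv X X' -> strong_equiv Y Y' ->
  rho0 X Y = rho0 X' Y'.
Proof.
move=> XX' YY'; apply: eq_integral => r _.
exact: rho0_integrand_strong_equiv.
Qed.

Lemma rho0_strong_equiv0 X Y : strong_equiv X Y -> rho0 X Y = 0.
Proof.
move=> XY; apply: integral0_eq => r _.
exact: rho0_integrand_strong_equiv0.
Qed.

(** A null set cannot contain the interval between [max 0 (r - d)] and [r]. *)
Lemma rho0_eq0_left_dense X Y (r : {posnum R}) (d : R) :
  geodesic X -> geodesic Y -> rho0 X Y = 0 -> (0 < d)%R ->
  exists2 s : {posnum R}, (r%:num - d < s%:num < r%:num)%R &
    rho0_integrand X Y s%:num = 0.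
Proof.
move=> gX gY XY0 d0.
have [N [mN N0 DN]] :
    ae_eq mu (`]0%R, +oo[%classic : set R) (rho0_integrand X Y) (cst 0).
  apply/ae_eq_integral_abs => //; first exact: measurable_rho0_integrand.
  rewrite -XY0; apply: eq_integral => s _.
  by rewrite gee0_abs// rho0_integrand_ge0.
apply: contrapT => H.
pose a := Num.max 0%R (r%:num - d)%R.
have ar : (a < r%:num)%R by rewrite gt_max ltrBlDr ltrDl d0 andbT.
have aN : (`]a, r%:num[%classic : set R) `<=` N.
  move=> s; rewrite /= in_itv/= gt_max => /andP[/andP[s0 ds] sr].
  apply: DN => /= Hs; apply: H; exists (PosNum s0) => /=; first by rewrite ds.
  by apply: Hs; rewrite in_itv/= s0.
have : mu (`]a, r%:num[%classic : set R) <= mu N by apply: le_measure; rewrite ?inE.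
by rewrite N0 lebesgue_measure_itv/= lte_fin ar -EFinB lee_fin subr_le0 leNgt ar.
Qed.

Lemma rho0_eq0_strong_equiv X Y : geodesic X -> geodesic Y ->
  rho0 X Y = 0 -> strong_equiv X Y.
Proof.
have H X' Y' (r : {posnum R}) : geodesic X' -> geodesic Y' -> rho0 X' Y' = 0 ->
    precsim (ptball X' r) (ptball Y' r).
  move=> gX gY XY0; apply: precsim_ball_left_limit => // d d0.
  have [s rs sXY] := rho0_eq0_left_dense r gX gY XY0 d0.
  by exists s => //; exact: rho0_integrand_eq0.
move=> gX gY XY0 r; split; first exact: H.
have YX0 : rho0 Y X = 0 by rewrite rho0_sym.
exact: H YX0.
Qed.

End Rho0.

Theorem theorem5p11 (R : realType) :
  (forall X Y : ptMetric R, G0 X -> G0 Y ->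
     measurable_fun (`]0%R, +oo[ : set R) (rho0_integrand X Y)) /\
  pseudometric_on_classes (@G0 R) (@rho0 R) /\
  (forall X Y : ptMetric R, G0 X -> G0 Y ->
     (rho0 X Y = 0 <-> strong_equiv X Y)).
Proof.
split; first exact: measurable_rho0_integrand.
split; last first.
  move=> X Y gX gY; split; first exact: rho0_eq0_strong_equiv.
  exact: rho0_strong_equiv0.
split.
- move=> X X' Y Y' _ _ _ _ XX' YY'.
  by apply: rho0_strong_equiv; exact: isometric_strong_equiv.
- by move=> X Y gX gY; rewrite rho0_ge0 rho0_lty.
- by move=> X _; apply: rho0_strong_equiv0 => r; split; exact: precsim_refl.
- by move=> X Y _ _; exact: rho0_sym.
- exact: rho0_triangle.
Qed.
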